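(* Let $\Lambda$ be a Delone set in $\mathbb{R}^N$ with neighbor relation $\mathcal{N}$. The metric measure spaces $(\mathbb{R}^N,d,\lambda)$, $(G_c(\Lambda,\mathcal{N}),d_c,\mu_c)$ and $(G_m(\Lambda,\mathcal{N}),d_m,\mu_m)$ are (pairwise) roughly isometric.
   Context: Euclidean setting: $\|\cdot\|$ is the Euclidean norm on $\mathbb{R}^N$, $d(x,y)=\|x-y\|$, $\lambda$ is Lebesgue measure, $B_S$ is the closed ball of radius $S$ around the origin, $[x,y]=\{x+t(y-x):t\in[0,1]\}$ and $]x,y[=\{x+t(y-x):t\in(0,1)\}$. Delone set: a subset $\Lambda\subset\mathbb{R}^N$ is a Delone set if there are $r,R>0$ with $\|x-y\|\ge 2r$ for all distinct $x,y\in\Lambda$ and $\mathbb{R}^N=\bigcup_{x\in\Lambda}(x+B_R)$. Neighbor relation: a neighbor relation on a Delone set $\Lambda$ is a subset $\mathcal{N}\subset\Lambda\times\Lambda$ such that for some $S>0$: (N0) $\mathcal{N}$ is symmetric and contains the diagonal $\{(x,x):x\in\Lambda\}$; (N1) $\|x-y\|\le S$ for all $(x,y)\in\mathcal{N}$; (N2) for all $x,y\in\Lambda$ there is a finite sequence $(x_0,\dots,x_n)$ in $\Lambda$ with $x_0=x$, $x_n=y$, $(x_i,x_{i+1})\in\mathcal{N}$ for $i=0,\dots,n-1$, and $\{x_0,\dots,x_n\}\subset[x,y]+B_S$. Write $x\sim y$ if $(x,y)\in\mathcal{N}$. Combinatorial graph: $G_c(\Lambda,\mathcal{N})$ has vertex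 set $\Lambda$ and edges the pairs $(x,y)\in\mathcal{N}$; as a metric measure space its underlying set is $\Lambda$. A path of length $n$ from $x$ to $y$ is a sequence $(x_0,\dots,x_n)$ in $\Lambda$ with $x_0=x$, $x_n=y$, $x_i\sim x_{i+1}$ for $i=0,\dots,n-1$. $d_c(x,y)$ is the minimal length of a path from $x$ to $y$, and $\mu_c$ is the counting measure on $\Lambda$. Metric graph: let $S(\Lambda,\mathcal{N})=\{(s,(x,y))\in\mathbb{R}^N\times\mathcal{N}: s\in[x,y]\}$ and $G_m(\Lambda,\mathcal{N})=S(\Lambda,\mathcal{N})/\sim$, where here $\sim$ is the equivalence relation generated by $(s,(x,y))\sim(s,(y,x))$ and $(x,(x,y))\sim(x,(x,z))$ for all $(x,y),(x,z)\in\mathcal{N}$ and $s\in[x,y]$. The class of $(s,(x,y))$ is written $[(s,(x,y))]$. The vertices are the points $[(x,(x,y))]$ (identified with $x\in\Lambda$). The metric edges are the sets $e_{(x,y)}=\{[(s,(x,y))]:s\in\,]x,y[\}$ with $(x,y)\in\mathcal{N}$, $x\neq y$; note $e_{(x,y)}=e_{(y,x)}$. Each such edge is identified with an open interval of length $\|x-y\|$. Metric $d_m$: for $a,b\in G_m(\Lambda,\mathcal{N})$ and $n\ge 1$, a sequence $(x_0,\dots,x_{n+1})$ in $\Lambda$ with $(x_j,x_{j+1})\in\mathcal{N}$ for $j=0,\dots,n$, $a=[(s,(x_0,x_1))]$ and $b=[(t,(x_n,x_{n+1}))]$ is an admissible path joining $a$ and $b$, with length $\|s-x_1\|+\sum_{j=1}^{n-1}\|x_j-x_{j+1}\|+\|x_n-t\|$.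 If $a=[(s,(x,y))]$ and $b=[(t,(x,y))]$ lie on a common closed edge, the direct segment of length $\|s-t\|$ is also admitted. Then $d_m(a,b)$ is the infimum of all these lengths. Measure $\mu_m$: the measure induced on $G_m(\Lambda,\mathcal{N})$ by Lebesgue measure on the edges (each edge $e_{(x,y)}=e_{(y,x)}$ counted once, the set of vertices having measure zero). Rough isometry: two metric measure spaces $(X_j,e_j,\mu_j)$, $j=1,2$, are roughly isometric if there exist a map $\phi:X_1\to X_2$ and constants $\varrho>0$, $\delta>1$ such that (i) $\bigcup_{x\in X_1}B_{e_2}(\phi(x),\varrho)=X_2$; (ii) $\frac1\delta(e_1(x,y)-\varrho)\le e_2(\phi(x),\phi(y))\le\delta(e_1(x,y)+\varrho)$ for all $x,y\in X_1$; (iii) $\frac1\delta\mu_1(B_{e_1}(x,\varrho))\le\mu_2(B_{e_2}(\phi(x),\varrho))\le\delta\mu_1(B_{e_1}(x,\varrho))$ for all $x\in X_1$. Here $B_{e_j}(z,s)$ is the closed ball in $X_j$ around $z$ of radius $s$ with respect to $e_j$. *)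

(* Defs.v *)
From HB Require Import structures.
From Stdlib Require Import Relation_Operators.
From mathcomp Require Import all_boot all_order all_algebra.
From mathcomp Require Import all_classical all_reals all_analysis.

Set Implicit Arguments.
Unset Strict Implicit.
Unset Printing Implicit Defensive.

Import Order.TTheory GRing.Theory Num.Theory.
Import numFieldNormedType.Exports.

Local Open Scope classical_set_scope.
Local Open Scope ring_scope.
Local Open Scope quotient_scope.

(* The library norm `|v| on 'rV[R]_n is the sup norm, hence this one. *)
Definition enorm (R : realType) (n : nat) (v : 'rV[R]_n) : R :=
  Num.sqrt (\sum_i v 0 i ^+ 2).

Definition edist (R : realType) (n : nat) (x y : 'rV[R]_n) : R := enorm (x - y).

Definition segment (R : realType) (n : nat) (x y : 'rV[R]_n) : set 'rV[R]_n :=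
  [set x + t *: (y - x) | t in `[0, 1]].

Section borel_row.
Context (R : realType) (n : nat).

Let coor (i : 'I_n) (v : 'rV[R]_n) : measurableTypeR R := v 0 i.

Let row_set0 : g_sigma_preimage coor set0.
Proof. exact: sigma_algebra0. Qed.

Let row_setC A : g_sigma_preimage coor A -> g_sigma_preimage coor (~` A).
Proof. exact: sigma_algebraC. Qed.

Let row_bigcup (F : _^nat) : (forall i, g_sigma_preimage coor (F i)) ->
  g_sigma_preimage coor (\bigcup_i (F i)).
Proof. exact: sigma_algebra_bigcup. Qed.

(* The sigma-algebra generated by the n coordinates, i.e. the Borel sets. *)
HB.instance Definition _ :=
  @isMeasurable.Build (measure_tuple_display default_measure_display)
    'rV[R]_n (g_sigma_preimage coor) row_set0 row_setC row_bigcup.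

Lemma measurable_coor (i : 'I_n) : measurable_fun [set: 'rV[R]_n] (coor i).
Proof.
move=> _ Y mY; rewrite setTI; apply: sub_sigma_algebra => /=.
rewrite -bigcup_seq/=; exists i => /=; first by rewrite mem_index_enum.
by exists Y => //; rewrite setTI.
Qed.

Lemma measurable_fun_coor d (T : measurableType d) (f : T -> 'rV[R]_n) :
  (forall i, measurable_fun [set: T] (coor i \o f)) ->
  measurable_fun [set: T] f.
Proof.
move=> mf.
have prefS : g_sigma_preimage (fun i => coor i \o f) `<=` measurable.
  apply: smallest_sub; first exact: sigma_algebra_measurable.
  apply: (big_ind (fun G : set (set T) => G `<=` measurable)) => //.
    by move=> A B mA mB; rewrite subUset.
  by move=> i _ A [B mB <-]; exact: mf.
move=> _ A mA; apply: prefS; rewrite g_sigma_preimage_comp.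
by exists A.
Qed.

End borel_row.

Definition row_cons (R : realType) (n : nat)
    (p : measurableTypeR R * 'rV[R]_n) : 'rV[R]_n.+1 :=
  row_mx (const_mx p.1 : 'M[R]_1) p.2.

Section lebesgue_row_succ.
Context (R : realType) (n : nat).

Lemma measurable_row_cons : measurable_fun setT (@row_cons R n).
Proof.
apply: measurable_fun_coor => i.
rewrite (_ : _ \o _ = fun p : measurableTypeR R * 'rV[R]_n =>
   match fintype.split (i : 'I_(1 + n)) with inl _ => p.1 | inr j => p.2 0 j end).
  case: fintype.split => j; first exact: measurable_fst.
  exact: (measurableT_comp (measurable_coor j) measurable_snd).
apply/funext => p /=; rewrite /row_cons [LHS]mxE.
by case: fintype.split => j //; rewrite mxE.
Qed.

Let uncons (v : 'rV[R]_(1 + n)) : measurableTypeR R * 'rV[R]_n :=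
  (v 0 0, rsubmx v).

Let measurable_uncons : measurable_fun setT uncons.
Proof.
apply/measurable_fun_pairP; split; first exact: measurable_coor.
apply: measurable_fun_coor => i.
rewrite (_ : _ \o _ = fun v : 'rV[R]_(1 + n) => v 0 (rshift 1 i)).
  exact: measurable_coor.
by apply/funext => v /=; rewrite mxE.
Qed.

Variable m : {sigma_finite_measure set 'rV[R]_n -> \bar R}.

Definition lebesgue_row_succ : set 'rV[R]_n.+1 -> \bar R :=
  pushforward (lebesgue_measure \x m)%E (@row_cons R n).

Let prod :
    {measure set (measurableTypeR R * 'rV[R]_n)%type -> \bar R} :=
  (lebesgue_measure \x m)%E.

HB.instance Definition _ := Measure.copy lebesgue_row_succ
  (measure_function_pushforward__canonical__measure_function_Measure
     prod measurable_row_cons).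

Let row_consK : uncons \o @row_cons R n = id.
Proof.
apply/funext => -[x v]; rewrite /uncons /row_cons /= [rsubmx _]row_mxKr.
congr pair; rewrite (_ : (0 : 'I_(1 + n)) = lshift n 0); last exact/val_inj.
by rewrite row_mxEl mxE.
Qed.

Let lebesgue_row_succ_sigma_finite : sigma_finite setT lebesgue_row_succ.
Proof.
have /sigma_finiteP[F [TF ndF Foo]] :=
  sigma_finiteT (@lebesgue_measure R).
have /sigma_finiteP[G [TG ndG Goo]] := sigma_finiteT m.
exists (fun k => uncons @^-1` (F k `*` G k)).
  rewrite -preimage_bigcup; apply/esym/seteqP; split=> // v _ /=.
  have [k _ Fk] : (\bigcup_i F i) (uncons v).1 by rewrite -TF.
  have [l _ Gl] : (\bigcup_i G i) (uncons v).2 by rewrite -TG.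
  exists (maxn k l) => //; split.
  - by move: Fk; exact/subsetPset/ndF/leq_maxl.
  - by move: Gl; exact/subsetPset/ndG/leq_maxr.
move=> k; have [mF Fk] := Foo k; have [mG Gk] := Goo k.
have mFG : measurable (F k `*` G k) by exact: measurableX.
split; first by rewrite -[X in measurable X]setTI; exact: measurable_uncons.
rewrite /lebesgue_row_succ /pushforward -comp_preimage row_consK.
rewrite [ltLHS](product_measure1E lebesgue_measure m mF mG).
by rewrite lte_mul_pinfty// ge0_fin_numE.
Qed.

HB.instance Definition _ := Measure_isSigmaFinite.Build _ _ _
  lebesgue_row_succ lebesgue_row_succ_sigma_finite.

End lebesgue_row_succ.

(* Lebesgue measure on the Borel sets of R^n, as the n-fold product of the
   one-dimensional Lebesgue measure; R^0 is a point of mass 1. *)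
Fixpoint lebesgue_row (R : realType) (n : nat) :
    {sigma_finite_measure set 'rV[R]_n -> \bar R} :=
  match n with
  | 0 => \d_(0 : 'rV[R]_0)
  | n'.+1 => lebesgue_row_succ (lebesgue_row R n')
  end.

Definition delone (R : realType) (n : nat) (L : set 'rV[R]_n) : Prop :=
  exists r s : R, [/\ 0 < r, 0 < s,
    (forall x y, L x -> L y -> x != y -> 2 * r <= enorm (x - y)) &
    \bigcup_(x in L) [set z | enorm (z - x) <= s] = setT].

Definition neighbor_relation (R : realType) (n : nat) (L : set 'rV[R]_n)
    (N : set ('rV[R]_n * 'rV[R]_n)) : Prop :=
  N `<=` L `*` L /\
  exists S : R, 0 < S /\
    [/\ (forall x y, N (x, y) -> N (y, x)) /\ (forall x, L x -> N (x, x)),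
        (forall x y, N (x, y) -> enorm (x - y) <= S) &
        (forall x y, L x -> L y ->
          exists (k : nat) (p : nat -> 'rV[R]_n),
            [/\ p 0%N = x /\ p k = y,
                (forall i, (i <= k)%N -> L (p i)),
                (forall i, (i < k)%N -> N (p i, p i.+1)) &
                (forall i, (i <= k)%N ->
                  exists2 z, segment x y z & enorm (p i - z) <= S)])].

(* Only the distance and the measures of closed balls enter the notion of rough
   isometry, so the record carries just these data. *)
Record metric_measure_space (R : realType) := MetricMeasureSpace {
  mms_sort :> Type;
  mms_dist : mms_sort -> mms_sort -> R;
  mms_measure : set mms_sort -> \bar R
}.

Definition mms_cball (R : realType) (X : metric_measure_space R)
  (x : X) (s : R) : set X := [set y | mms_dist x y <= s].

Definition roughly_isometric (R : realType) (X Y : metric_measure_space R) :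
    Prop :=
  exists (phi : X -> Y) (rho delta : R), [/\ 0 < rho, 1 < delta,
    \bigcup_x mms_cball (phi x) rho = setT,
    (forall x y : X,
      delta^-1 * (mms_dist x y - rho) <= mms_dist (phi x) (phi y) /\
      mms_dist (phi x) (phi y) <= delta * (mms_dist x y + rho)) &
    (forall x : X,
      ((delta^-1)%:E * mms_measure (mms_cball x rho)
         <= mms_measure (mms_cball (phi x) rho))%E /\
      (mms_measure (mms_cball (phi x) rho)
         <= delta%:E * mms_measure (mms_cball x rho))%E)].

Definition euclidean_space (R : realType) (n : nat) : metric_measure_space R :=
  MetricMeasureSpace (@edist R n) (lebesgue_row R n).

Section graphs.
Context (R : realType) (n : nat).
Variables (L : set 'rV[R]_n) (N : set ('rV[R]_n * 'rV[R]_n)).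

Definition graph_path (k : nat) (x y : L) : Prop :=
  exists p : nat -> L, [/\ p 0%N = x, p k = y &
    forall i, (i < k)%N -> N (val (p i), val (p i.+1))].

(* The default 0 is irrelevant: a neighbor relation makes L connected. *)
Definition cgraph_dist (x y : L) : nat :=
  xget 0%N [set k | graph_path k x y /\
                    forall j, graph_path j x y -> (k <= j)%N].

Definition cgraph : metric_measure_space R :=
  MetricMeasureSpace (fun x y : L => (cgraph_dist x y)%:R) counting.

Definition edge_points : set ('rV[R]_n * ('rV[R]_n * 'rV[R]_n)) :=
  [set q | N q.2 /\ segment q.2.1 q.2.2 q.1].

Inductive glue (a b : edge_points) : Prop :=
| glue_flip s x y of val a = (s, (x, y)) & val b = (s, (y, x))
| glue_vertex x y z of val a = (x, (x, y)) & val b = (x, (x, z)).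

Definition glued (a b : edge_points) : bool :=
  `[< clos_refl_sym_trans edge_points glue a b >].

Lemma glued_refl : reflexive glued.
Proof. by move=> a; apply/asboolP; exact: rst_refl. Qed.

Lemma glued_sym : symmetric glued.
Proof. by move=> a b; apply/asboolP/asboolP; exact: rst_sym. Qed.

Lemma glued_trans : transitive glued.
Proof.
move=> b a c /asboolP ab /asboolP bc; apply/asboolP.
exact: rst_trans ab bc.
Qed.

Canonical glued_equiv := EquivRel glued glued_refl glued_sym glued_trans.

Definition mgraph_point := {eq_quot glued_equiv}.

(* [mgraph_class q a]: q = (s, (x, y)) with (x, y) in N and s in [x, y], and a
   is its class. *)
Definition mgraph_class (q : 'rV[R]_n * ('rV[R]_n * 'rV[R]_n))
    (a : mgraph_point) : Prop :=
  exists2 p : edge_points, val p = q & \pi_mgraph_point p = a.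

Definition mgraph_path_lengths (a b : mgraph_point) : set R :=
  [set l | exists (k : nat) (s t : 'rV[R]_n) (p : nat -> 'rV[R]_n),
    [/\ (0 < k)%N,
        (forall j, (j <= k)%N -> N (p j, p j.+1)),
        mgraph_class (s, (p 0%N, p 1%N)) a,
        mgraph_class (t, (p k, p k.+1)) b &
        l = enorm (s - p 1%N)
            + \sum_(1 <= j < k) enorm (p j - p j.+1) + enorm (p k - t)]].

Definition mgraph_segment_lengths (a b : mgraph_point) : set R :=
  [set l | exists s t x y : 'rV[R]_n,
    [/\ mgraph_class (s, (x, y)) a, mgraph_class (t, (x, y)) b &
        l = enorm (s - t)]].

Definition mgraph_dist (a b : mgraph_point) : R :=
  inf (mgraph_path_lengths a b `|` mgraph_segment_lengths a b).

(* The trace of A on the edge e_(x,y), read in the arc length parameter u in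
   ]0, |x - y|[. *)
Definition edge_trace (A : set mgraph_point) (e : 'rV[R]_n * 'rV[R]_n) :
    set R :=
  [set u | 0 < u < enorm (e.2 - e.1) /\
    exists2 a, A a &
      mgraph_class (e.1 + (u / enorm (e.2 - e.1)) *: (e.2 - e.1), e) a].

(* The sum over ordered pairs meets every edge e_(x,y) = e_(y,x) twice, whence
   the factor 1/2. *)
Definition mgraph_measure (A : set mgraph_point) : \bar R :=
  ((2^-1)%:E * \esum_(e in [set e | N e /\ e.1 != e.2])
                 lebesgue_measure (edge_trace A e))%E.

Definition mgraph : metric_measure_space R :=
  MetricMeasureSpace mgraph_dist mgraph_measure.

End graphs.

(* Main.v *)
Require Import Defs.
From mathcomp Require Import all_boot all_order all_algebra finmap.
From mathcomp Require Import all_classical all_reals all_analysis.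
From mathcomp Require Import measurable_realfun ring lra.

(** Rough isometry only sees large scales, and at large scales each of the three
    spaces X is a copy of Euclidean space: it has a map f to R^n (the identity,
    the inclusion of the vertices, the position of a point on its edge) whose
    image is coarsely dense and for which d(x, y) and |f x - f y| agree up to
    multiplicative and additive constants.  Moreover, for each large radius, the
    measures of all balls of that radius lie between two positive constants.  Two spaces X
    and Y with these properties are roughly isometric
    ([coarsely_euclidean_roughly_isometric]): send x to a point of Y whose
    position is close to that of x.  This relation is symmetric in X and Y, so
    the six rough isometries come from three facts.

    For the Euclidean space only the measure of balls is at stake, and balls
    are compared with cubes.

    In the metric graph |f x - f y| <= d(x, y), and in the combinatorial graph
    |f x - f y| <= S d(x, y), since edges have length at most S.  The converse estimate is the heart of the matter
    ([short_chain]).  Two vertices x and y are joined by a chain that stays in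
    the tube of radius S around the segment [x, y].  Without its loops the chain
    visits each vertex at most once, and a tube of length |x - y| contains at
    most M (|x - y| + 2) points of a uniformly discrete set ([tube_count]); so
    the chain has at most that many steps.  In the metric graph the same chain
    yields a path of length at most S times as large, plus the two ends.

    Uniform discreteness also bounds the number of vertices, and hence the
    number of edges, that meet a ball of given radius ([finite_packing]).  This
    bounds the measures of balls in the graphs from above.  From below, a ball
    in the combinatorial graph contains its centre, and a ball of radius 2S in
    the metric graph contains a whole edge, of length at least 2r, because
    every vertex has a neighbor other than itself ([exists_other_neighbor]). *)

Set Implicit Arguments.
Unset Strict Implicit.
Unset Printing Implicit Defensive.

Import Order.TTheory GRing.Theory Num.Theory.

Local Open Scope classical_set_scope.
Local Open Scope ring_scope.

(** * The Euclidean norm and segments *)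

Section euclidean_norm.
Context (R : realType) (n : nat).
Implicit Types u v x y z : 'rV[R]_n.

Lemma sqsum_ge0 v : 0 <= \sum_i v 0 i ^+ 2.
Proof. by apply: sumr_ge0 => i _; rewrite sqr_ge0. Qed.

Lemma enorm_ge0 v : 0 <= enorm v.
Proof. exact: sqrtr_ge0. Qed.

Lemma enorm_sqr v : enorm v ^+ 2 = \sum_i v 0 i ^+ 2.
Proof. by rewrite sqr_sqrtr ?sqsum_ge0. Qed.

Lemma enorm_le v (c : R) : 0 <= c ->
  (enorm v <= c) = (\sum_i v 0 i ^+ 2 <= c ^+ 2).
Proof.
by move=> c0; rewrite -enorm_sqr ler_pXn2r // nnegrE ?enorm_ge0.
Qed.

Lemma enorm0 : enorm (0 : 'rV[R]_n) = 0.
Proof.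
by rewrite /enorm big1 ?sqrtr0 // => i _; rewrite mxE expr0n.
Qed.

Lemma enorm_coord v i : `|v 0 i| <= enorm v.
Proof.
rewrite -(@ler_pXn2r _ 2) ?nnegrE ?enorm_ge0 // real_normK ?num_real //.
by rewrite enorm_sqr (bigD1 i) //= lerDl sumr_ge0 // => j _; rewrite sqr_ge0.
Qed.

Lemma enorm_coord_bound v (c : R) : 0 <= c ->
  (forall i, `|v 0 i| <= c) -> enorm v <= n%:R * c.
Proof.
move=> c0 vc; rewrite enorm_le ?mulr_ge0 // exprMn.
apply: (@le_trans _ _ (\sum_(i < n) c ^+ 2)).
  apply: ler_sum => i _; rewrite -real_normK ?num_real //.
  by rewrite ler_pXn2r ?nnegrE.
rewrite sumr_const card_ord -(mulr_natl (c ^+ 2)) ler_wpM2r ?sqr_ge0 //.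
by rewrite -natrX ler_nat; case: (n) => // k; rewrite expnS expn1 leq_pmulr.
Qed.

Lemma enorm_eq0 v : enorm v = 0 -> v = 0.
Proof.
move=> v0; apply/rowP => i; rewrite mxE; apply/normr0_eq0.
by apply/le_anti; rewrite normr_ge0 -v0 enorm_coord.
Qed.

Lemma enormZ (a : R) v : enorm (a *: v) = `|a| * enorm v.
Proof.
rewrite /enorm -sqrtr_sqr -sqrtrM ?sqr_ge0 // mulr_sumr.
by congr Num.sqrt; apply: eq_bigr => i _; rewrite mxE exprMn.
Qed.

Lemma enormN v : enorm (- v) = enorm v.
Proof. by rewrite -scaleN1r enormZ normrN1 mul1r. Qed.

Lemma enormB u v : enorm (u - v) = enorm (v - u).
Proof. by rewrite -enormN opprB. Qed.

(** Minkowski's inequality: for positive norms a and b, convexity of the square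
    gives (u_i + v_i)^2 <= (a + b) (u_i^2 / a + v_i^2 / b) for each i, and the
    right-hand sides sum to (a + b)^2. *)
Lemma enormD u v : enorm (u + v) <= enorm u + enorm v.
Proof.
have [/enorm_eq0 ->|a0] := eqVneq (enorm u) 0.
  by rewrite add0r enorm0 add0r.
have [/enorm_eq0 ->|b0] := eqVneq (enorm v) 0.
  by rewrite addr0 enorm0 addr0.
have {a0}a0 : 0 < enorm u by rewrite lt_def a0 enorm_ge0.
have {b0}b0 : 0 < enorm v by rewrite lt_def b0 enorm_ge0.
rewrite enorm_le ?addr_ge0 ?enorm_ge0 //.
set a := enorm u in a0 *; set b := enorm v in b0 *.
apply: (@le_trans _ _
  (\sum_i (a + b) * (a^-1 * u 0 i ^+ 2 + b^-1 * v 0 i ^+ 2))).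
  apply: ler_sum => i _; rewrite mxE -subr_ge0.
  have -> : (a + b) * (a^-1 * u 0 i ^+ 2 + b^-1 * v 0 i ^+ 2)
      - (u 0 i + v 0 i) ^+ 2 = (a * b)^-1 * (b * u 0 i - a * v 0 i) ^+ 2.
    by field; rewrite !gt_eqF.
  by rewrite mulr_ge0 ?sqr_ge0 // invr_ge0 mulr_ge0 // ltW.
rewrite -mulr_sumr big_split /= -!mulr_sumr -!enorm_sqr -/a -/b.
by rewrite !expr2 !mulKf ?gt_eqF.
Qed.

Lemma enorm_triangle y x z : enorm (x - z) <= enorm (x - y) + enorm (y - z).
Proof. by rewrite -[x - z](subrKA y) enormD. Qed.

Lemma enorm_quad x y z t :
  enorm (x - t) <= enorm (x - y) + enorm (y - z) + enorm (z - t).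
Proof.
rewrite (le_trans (enorm_triangle y _ _)) // -addrA lerD2l.
exact: enorm_triangle.
Qed.

Lemma enorm_chain (p : nat -> 'rV[R]_n) k : (0 < k)%N ->
  enorm (p 1%N - p k) <= \sum_(1 <= j < k) enorm (p j - p j.+1).
Proof.
elim: k => [//|[|k] IHk] _; first by rewrite subrr enorm0 big_geq.
rewrite big_nat_recr //= (le_trans (enorm_triangle (p k.+1) _ _)) //.
by rewrite lerD2r IHk.
Qed.

Lemma segment_sym x y : segment x y `<=` segment y x.
Proof.
move=> _ [t t01 <-]; exists (1 - t).
  by move: t01; rewrite /= !in_itv /= => /andP[]; lra.
by apply/rowP => i; rewrite !mxE; ring.
Qed.

Lemma segment_enorm x y z : segment x y z -> enorm (z - x) <= enorm (x - y).
Proof.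
move=> [t /= + <-]; rewrite in_itv /= => /andP[t0 t1].
by rewrite addrC addKr enormZ ger0_norm // enormB ler_piMl ?enorm_ge0.
Qed.

End euclidean_norm.

(** * Spaces coarsely equivalent to a Euclidean space *)

Section coarse_chart.
Context (R : realType) (n : nat).

(** One constant K serves as slope, as additive error and as density radius;
    nonnegative distances allow it to be enlarged, so that two charts can share
    it. *)
Definition coarse_chart (X : metric_measure_space R) (f : X -> 'rV[R]_n)
    (K : R) : Prop :=
  [/\ forall x y : X, 0 <= mms_dist x y,
      forall x y : X, enorm (f x - f y) <= K * (mms_dist x y + K),
      forall x y : X, mms_dist x y <= K * (enorm (f x - f y) + K) &
      forall z, exists x, enorm (f x - z) <= K].

(** The bounds hold for all large radii because a rough isometry compares balls
    of the same radius in the two spaces, and that radius must also exceed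
    constants of the charts. *)
Definition bounded_geometry (X : metric_measure_space R) : Prop :=
  exists rho0 : R, forall rho, rho0 <= rho -> exists c C : R, 0 < c /\
    forall x : X, (c%:E <= mms_measure (mms_cball x rho) <= C%:E)%E.

Definition coarsely_euclidean (X : metric_measure_space R) : Prop :=
  (exists f K, 0 < K /\ @coarse_chart X f K) /\ bounded_geometry X.

Lemma coarse_chart_le (X : metric_measure_space R) f (K K' : R) :
  0 < K -> K <= K' -> @coarse_chart X f K -> coarse_chart f K'.
Proof.
move=> K0 KK' [d0 fd df fs]; split=> // [x y|x y|z].
- apply: (le_trans (fd x y)); apply: ler_pM; rewrite ?(ltW K0) //.
    by rewrite addr_ge0 // ltW.
  by rewrite lerD2l.
- apply: (le_trans (df x y)); apply: ler_pM; rewrite ?(ltW K0) //.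
    by rewrite addr_ge0 ?enorm_ge0 // ltW.
  by rewrite lerD2l.
- by have [x fx] := fs z; exists x; exact: le_trans fx KK'.
Qed.

(** The map sends x to a point of Y whose chart value is close to that of x.
    Composing the two estimates of the charts through the triangle inequality
    of the Euclidean norm spares the metric axioms of X and Y.  The radius rho
    may be as large as wished, so that the measure condition reduces to
    uniform bounds for balls of one common radius. *)
Theorem coarsely_euclidean_roughly_isometric (X Y : metric_measure_space R) :
  coarsely_euclidean X -> coarsely_euclidean Y -> roughly_isometric X Y.
Proof.
move=> [[f [K1 [K10 fK1]]] [r1 X1]] [[g [K2 [K20 gK2]]] [r2 Y2]].
pose K : R := Num.max K1 K2.
have K0 : 0 < K by rewrite lt_max K10.
have fK : coarse_chart f K.
  by apply: (coarse_chart_le K10) fK1; rewrite le_max lexx.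
have gK : coarse_chart g K.
  by apply: (coarse_chart_le K20) gK2; rewrite le_max lexx orbT.
clearbody K; move: fK gK => {fK1 gK2} [dX0 fd df fs] [dY0 gd dg gs].
have /choice[phi phiP] : forall x : X, exists y : Y, enorm (g y - f x) <= K.
  by move=> x; exact: gs.
(* The charts compose to d(phi x, phi y) <= K^2 d(x, y) + K^3 + 3 K^2 and to the
   same bound with the two distances exchanged. *)
pose rho : R := Num.max (K ^+ 3 + 3 * K ^+ 2 + K + 3) (Num.max r1 r2).
have rhoK : K ^+ 3 + 3 * K ^+ 2 + K + 3 <= rho by rewrite le_max lexx.
have rho1 : r1 <= rho by rewrite !le_max lexx orbT.
have rho2 : r2 <= rho by rewrite !le_max lexx !orbT.
clearbody rho.
have [c1 [C1 [c10 ball1]]] := X1 _ rho1.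
have [c2 [C2 [c20 ball2]]] := Y2 _ rho2.
pose delta : R := Num.max (K ^+ 2 + 2) (Num.max (C1 / c2) (C2 / c1)).
have deltaK : K ^+ 2 + 2 <= delta by rewrite le_max lexx.
have delta1 : C1 <= delta * c2.
  by rewrite -ler_pdivrMr // !le_max lexx orbT.
have delta2 : C2 <= delta * c1.
  by rewrite -ler_pdivrMr // !le_max lexx !orbT.
clearbody delta.
have K2_0 : 0 <= K ^+ 2 by exact: sqr_ge0.
have K3_0 : 0 <= K ^+ 3 by rewrite exprn_ge0 // ltW.
have rho0 : 0 < rho by lra.
have delta0 : 0 < delta by lra.
exists phi, rho, delta; split => //; first by lra.
- apply/seteqP; split=> // y _; have [x xy] := fs (g y).
  exists x => //; rewrite /mms_cball /=.
  apply: (le_trans (dg _ _)).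
  have : enorm (g (phi x) - g y) <= K + K.
    rewrite (le_trans (enorm_triangle (f x) _ _)) //.
    by rewrite lerD.
  move=> h; apply: (@le_trans _ _ (K * (K + K + K))).
    by rewrite ler_pM2l // lerD2r.
  rewrite (_ : K * _ = 3 * K ^+ 2); last by ring.
  lra.
- move=> x y.
  have fg : enorm (g (phi x) - g (phi y)) <= enorm (f x - f y) + 2 * K.
    have := enorm_quad (g (phi x)) (f x) (f y) (g (phi y)).
    have := phiP x; have := phiP y; rewrite (enormB (g (phi y))); lra.
  have gf : enorm (f x - f y) <= enorm (g (phi x) - g (phi y)) + 2 * K.
    have := enorm_quad (f x) (g (phi x)) (g (phi y)) (f y).
    have := phiP x; have := phiP y; rewrite (enormB (g (phi x))); lra.
  split.
    rewrite ler_pdivrMl //.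
    have h : mms_dist x y <=
        K * (K * (mms_dist (phi x) (phi y) + K) + 2 * K + K).
      apply: (le_trans (df x y)); rewrite ler_pM2l // lerD2r.
      by apply: (le_trans gf); rewrite lerD2r.
    have e : K * (K * (mms_dist (phi x) (phi y) + K) + 2 * K + K) =
        K ^+ 2 * mms_dist (phi x) (phi y) + (K ^+ 3 + 3 * K ^+ 2) by ring.
    have : K ^+ 2 * mms_dist (phi x) (phi y) <=
        delta * mms_dist (phi x) (phi y).
      by apply: ler_wpM2r => //; lra.
    lra.
  have h : mms_dist (phi x) (phi y) <=
      K * (K * (mms_dist x y + K) + 2 * K + K).
    apply: (le_trans (dg _ _)); rewrite ler_pM2l // lerD2r.
    by apply: (le_trans fg); rewrite lerD2r.
  apply: (le_trans h).
  rewrite (_ : K * _ = K ^+ 2 * (mms_dist x y + (K + 3))); last by ring.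
  by apply: ler_pM; rewrite ?addr_ge0 //; lra.
- move=> x; have /andP[cx xC] := ball1 x.
  have /andP[cy yC] := ball2 (phi x); split.
    apply: (@le_trans _ _ (delta^-1%:E * C1%:E)%E).
      by rewrite lee_pmul2l // lte_fin invr_gt0.
    apply: le_trans cy; rewrite -EFinM lee_fin ler_pdivrMl //.
  apply: (le_trans yC); apply: (@le_trans _ _ (delta%:E * c1%:E)%E).
    by rewrite -EFinM lee_fin.
  by rewrite lee_pmul2l.
Qed.

End coarse_chart.

(** * Counting points of a uniformly discrete set *)

Lemma uniq_size_le_card (T : eqType) (F : finType) (g : T -> F) (s : seq T) :
  uniq s -> {in s &, injective g} -> (size s <= #|F|)%N.
Proof.
move=> us gi; rewrite -(size_map g); have /card_uniqP <- : uniq (map g s).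
  by rewrite map_inj_in_uniq.
exact: max_card.
Qed.

Lemma truncn_eq_dist (R : realType) (a b : R) : 0 <= a -> 0 <= b ->
  Num.truncn a = Num.truncn b -> `|a - b| < 1.
Proof.
move=> /truncn_itv/andP[a1 a2] /truncn_itv/andP[b1 b2] e.
move: a1 a2; rewrite e => a1 a2.
rewrite -natr1 in a2 b2; rewrite ltr_norml; lra.
Qed.

(** The grid of cubes with side h = 2r / (n + 1): two points in one cube are
    at distance at most n h < 2r, so each cube contains at most one point of L,
    and the number of cubes needed to cover a ball of radius T does not depend
    on its centre.  Recording the bound as an injection into a finite type lets
    it be combined with other finite data by taking products. *)
Lemma finite_packing (R : realType) (n : nat) (L : set 'rV[R]_n) (r T : R) :
  0 < r -> 0 <= T ->
  (forall x y, L x -> L y -> x != y -> 2 * r <= enorm (x - y)) ->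
  exists F : finType, forall z, exists g : 'rV[R]_n -> F,
    forall x y, L x -> L y -> enorm (x - z) <= T -> enorm (y - z) <= T ->
      g x = g y -> x = y.
Proof.
move=> r0 T0 sep; pose h : R := 2 * r / n.+1%:R.
have h0 : 0 < h by rewrite divr_gt0 // mulr_gt0.
pose K := Num.truncn (2 * T / h).
exists {ffun 'I_n -> 'I_K.+1} => z.
pose c (x : 'rV[R]_n) i := (x 0 i - z 0 i + T) / h.
exists (fun x => [ffun i => inord (Num.truncn (c x i))]) => x y Lx Ly xz yz g.
have c_itv u i : enorm (u - z) <= T -> 0 <= c u i <= 2 * T / h.
  move=> uz; have := le_trans (enorm_coord (u - z) i) uz.
  rewrite !mxE ler_norml => uzi.
  by rewrite divr_ge0 ?ler_pM2r ?invr_gt0 ?(ltW h0) //; lra.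
have ci i : `|x 0 i - y 0 i| <= h.
  have /andP[cx0 cxT] := c_itv x i xz; have /andP[cy0 cyT] := c_itv y i yz.
  have /truncn_eq_dist : Num.truncn (c x i) = Num.truncn (c y i).
    move/ffunP: g => /(_ i); rewrite !ffunE => /(congr1 val) /=.
    by rewrite !inordK // ltnS le_truncn.
  move=> /(_ cx0 cy0) /ltW.
  rewrite /c -mulrBl normrM (gtr0_norm (x := h^-1)) ?invr_gt0 //.
  rewrite ler_pdivrMr // mul1r.
  by congr (_ <= _); congr `|_|; ring.
apply/eqP; apply/negPn/negP => /(sep _ _ Lx Ly); apply/negP; rewrite -ltNge.
have /(enorm_coord_bound (ltW h0)) : forall i, `|(x - y) 0 i| <= h.
  by move=> i; rewrite !mxE.
move=> /le_lt_trans; apply.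
by rewrite mulrCA gtr_pMr ?mulr_gt0 // ltr_pdivrMr // mul1r ltr_nat.
Qed.

(** * Lebesgue measure of Euclidean balls *)

Section euclidean.
Context (R : realType).

Definition cube (n : nat) (z : 'rV[R]_n) (c : R) : set 'rV[R]_n :=
  [set v | forall i, z 0 i - c <= v 0 i <= z 0 i + c].

Lemma measurable_cube n (z : 'rV[R]_n) (c : R) : measurable (cube z c).
Proof.
have -> : cube z c = \bigcap_(i in [set: 'I_n])
    (fun v : 'rV[R]_n => v 0 i) @^-1` `[z 0 i - c, z 0 i + c].
  apply/seteqP; split=> v /= vz i.
    by move=> _; rewrite /= in_itv /= vz.
  by have := vz i I; rewrite /= in_itv.
apply: fin_bigcap_measurable => // i _.
rewrite -[X in measurable X]setTI.
by apply: measurable_coor => //; exact: measurable_itv.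
Qed.

Lemma row_cons0 n (a : measurableTypeR R) (v : 'rV[R]_n) :
  row_cons (a, v) 0 ord0 = a.
Proof.
rewrite (_ : ord0 = lshift n (0 : 'I_1)); last exact/val_inj.
by apply: etrans (row_mxEl _ _ _ _) _; rewrite mxE.
Qed.

Lemma row_consS n (a : measurableTypeR R) (v : 'rV[R]_n) (i : 'I_n) :
  row_cons (a, v) 0 (lift ord0 i) = v 0 i.
Proof.
rewrite (_ : lift ord0 i = rshift 1 i); last exact/val_inj.
exact: row_mxEr.
Qed.

Lemma lebesgue_row_cube n (z : 'rV[R]_n) (c : R) : 0 <= c ->
  lebesgue_row R n (cube z c) = ((2 * c) ^+ n)%:E.
Proof.
move=> c0; elim: n z => [|n IHn] z /=.
  rewrite expr0 diracE; rewrite mem_set //; by case.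
rewrite /lebesgue_row_succ /pushforward.
have -> : @row_cons R n @^-1` cube z c = `[z 0 0 - c, z 0 0 + c]%classic `*`
    cube (\row_i z 0 (lift ord0 i)) c.
  apply/seteqP; split=> -[a v] /=; rewrite in_itv /=.
    move=> av; split; first by have := av ord0; rewrite row_cons0.
    by move=> i; have := av (lift ord0 i); rewrite row_consS mxE.
  move=> -[a0 vi] i; case: (unliftP ord0 i) => [j ->|->].
    by have := vi j; rewrite row_consS mxE.
  by rewrite row_cons0.
rewrite [LHS](product_measure1E lebesgue_measure (lebesgue_row R n));
  last 2 first.
- exact: measurable_itv.
- exact: measurable_cube.
rewrite IHn exprS EFinM; congr (_ * _)%E.
apply: etrans (lebesgue_measure_itv `[z 0 0 - c, z 0 0 + c]) _.
rewrite /= lte_fin; case: ifPn => [_|].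
  by rewrite -EFinB; congr EFin; ring.
by rewrite -leNgt => h; congr EFin; lra.
Qed.

Lemma measurable_cball n (x : 'rV[R]_n) (rho : R) : 0 <= rho ->
  measurable [set y | enorm (x - y) <= rho].
Proof.
move=> rho0.
have -> : [set y | enorm (x - y) <= rho] =
    [set: 'rV[R]_n] `&` (fun y : 'rV[R]_n => \sum_i (x 0 i - y 0 i) ^+ 2) @^-1`
      `]-oo, rho ^+ 2].
  rewrite setTI; apply/funext => y; rewrite /= in_itv /= enorm_le //.
  by congr (is_true (_ <= _)); apply: eq_bigr => i _; rewrite !mxE.
have mf : measurable_fun [set: 'rV[R]_n]
    (fun y : 'rV[R]_n => \sum_i (x 0 i - y 0 i) ^+ 2 : measurableTypeR R).
  apply: measurable_sum => i; apply: measurable_funX; apply: measurable_funB.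
    exact: measurable_cst.
  exact: measurable_coor.
by apply: mf => //; exact: measurable_itv.
Qed.

(** Cubes have a computable measure, and every ball of radius rho >= n
    contains a cube with side 2 and lies in a cube with side 2 rho. *)
Lemma euclidean_bounded_geometry n : bounded_geometry (euclidean_space R n).
Proof.
exists n%:R => rho rho_n; exists (2 ^+ n), ((2 * rho) ^+ n).
have rho0 : 0 <= rho by exact: le_trans rho_n.
split=> [|x]; first by rewrite exprn_gt0.
have mB := measurable_cball x rho0.
rewrite /mms_cball /= -{1}(mulr1 2) -!(lebesgue_row_cube x) //.
apply/andP; split; apply: le_measure; rewrite ?inE //;
  try exact: measurable_cube.
  move=> v vx; apply: le_trans rho_n; rewrite /= /Defs.edist -(mulr1 n%:R).
  apply: enorm_coord_bound => // i.
  by have := vx i; rewrite !mxE ler_norml; lra.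
move=> v; rewrite /= /Defs.edist => xv i.
by have := le_trans (enorm_coord _ i) xv; rewrite !mxE ler_norml; lra.
Qed.

Lemma euclidean_coarsely_euclidean n :
  coarsely_euclidean n (euclidean_space R n).
Proof.
split; last exact: euclidean_bounded_geometry.
exists id, 1; split=> //; split=> [x y|x y|x y|z] /=.
- exact: enorm_ge0.
- by rewrite mul1r lerDl.
- by rewrite mul1r lerDl.
- by exists z; rewrite subrr enorm0.
Qed.

End euclidean.

(** * Lebesgue outer measure and counting measure on arbitrary sets *)

(** [lebesgue_measure] is an outer measure defined on all sets; so traces on
    edges can be compared without showing that they are measurable. *)
Lemma lebesgue_measure_mono (R : realType) (A B : set (measurableTypeR R)) :
  A `<=` B -> (lebesgue_measure A <= lebesgue_measure B)%E.
Proof. by move=> AB; apply: le_mu_ext. Qed.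

Lemma counting_le_card (R : realType) (T : choiceType) (F : finType)
    (A : set T) (g : T -> F) :
  {in A &, injective g} -> (counting A <= #|F|%:R%:E :> \bar R)%E.
Proof.
move=> gi; have size_le (B : {fset T}) : [set` B] `<=` A -> (#|` B | <= #|F|)%N.
  move=> BA; apply: (uniq_size_le_card (g := g)); first exact: fset_uniq.
  by move=> x y xB yB; apply: gi; apply: mem_set; exact: BA.
rewrite /counting; case: asboolP => [finA|infA].
  by rewrite lee_fin ler_nat size_le // fset_setK.
have [B /size_le] := @infinite_set_fset _ A #|F|.+1 infA.
by rewrite leqNgt => /negP.
Qed.

Lemma counting_ge1 (R : realType) (T : choiceType) (A : set T) (x : T) :
  A x -> (1%:E <= counting A :> \bar R)%E.
Proof.
move=> Ax; rewrite /counting; case: asboolP => [finA|_]; last by rewrite leey.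
rewrite lee_fin ler1n cardfs_gt0; apply/fset0Pn; exists x.
by rewrite in_fset_set //; exact: mem_set.
Qed.

(** * Neighbor relations on Delone sets *)

Section neighbors.
Context (R : realType) (n : nat).
Context (L : set 'rV[R]_n) (N : set ('rV[R]_n * 'rV[R]_n)) (r s S : R).
Context (r0 : 0 < r) (s0 : 0 < s) (S0 : 0 < S).
Context (sep : forall x y, L x -> L y -> x != y -> 2 * r <= enorm (x - y)).
Context (dense : forall z, exists2 x, L x & enorm (z - x) <= s).
Context (NL : N `<=` L `*` L).
Context (Nsym : forall x y, N (x, y) -> N (y, x)).
Context (Nrefl : forall x, L x -> N (x, x)).
Context (NS : forall x y, N (x, y) -> enorm (x - y) <= S).
Context (tube : forall x y, L x -> L y ->
  exists (k : nat) (p : nat -> 'rV[R]_n),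
    [/\ p 0%N = x /\ p k = y,
        (forall i, (i <= k)%N -> L (p i)),
        (forall i, (i < k)%N -> N (p i, p i.+1)) &
        (forall i, (i <= k)%N ->
          exists2 z, segment x y z & enorm (p i - z) <= S)]).

(** The number of points of L in the tube of radius S around [x, y] grows at
    most linearly in |x - y|: cut the segment into m pieces of length at most
    1, and send a point of the tube to the piece near it and to its cell in
    the packing around the end of that piece. *)
Lemma tube_count : exists M : nat, forall x y (q : seq 'rV[R]_n), uniq q ->
  (forall v, v \in q ->
    L v /\ exists2 z, segment x y z & enorm (v - z) <= S) ->
  (size q)%:R <= M%:R * (enorm (x - y) + 2).
Proof.
have T0 : 0 <= S + 1 by rewrite addr_ge0 // ltW.
have [F packF] := finite_packing r0 T0 sep.
exists #|F| => x y q uq qP.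
have /choice[G GP] := packF.
pose m := (Num.truncn (enorm (x - y))).+1.
have m_gt : enorm (x - y) < m%:R by exact: truncnS_gt.
have m_le : m.+1%:R <= enorm (x - y) + 2.
  by rewrite -(addn2 (Num.truncn _)) natrD lerD2r truncn_le enorm_ge0.
have m0 : 0 < m%:R :> R by rewrite ltr0n.
pose w (t : R) := x + t *: (y - x).
have /choice[t tP] : forall v, exists t : R, v \in q ->
    [/\ 0 <= t, t <= 1 & enorm (v - w t) <= S].
  move=> v; have [vq|_] := boolP (v \in q); last by exists 0.
  have [_ [_ [t /= t01 <-] vS]] := qP v vq.
  by exists t => _; move: t01; rewrite in_itv /= => /andP[].
pose j v := Num.truncn (t v * m%:R).
have jm v : v \in q -> (j v < m.+1)%N.
  move=> /tP[t0 t1 _]; rewrite truncn_lt_nat; last by rewrite mulr_ge0 // ltW.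
  by rewrite (@le_lt_trans _ _ m%:R) ?ltr_nat // ler_piMl // ltW.
have near v : v \in q -> enorm (v - w ((j v)%:R / m%:R)) <= S + 1.
  move=> /tP[t0 t1 vt]; apply: (le_trans (enorm_triangle (w (t v)) _ _)).
  rewrite lerD // /w opprD addrACA subrr add0r -scalerBl enormZ enormB.
  have /truncn_itv/andP[] : 0 <= t v * m%:R by rewrite mulr_ge0 // ltW.
  rewrite -/(j v) -natr1 => j1 j2.
  rewrite ger0_norm; last by rewrite subr_ge0 ler_pdivrMr.
  apply: (@le_trans _ _ (m%:R^-1 * m%:R)); last by rewrite mulVf // gt_eqF.
  apply: ler_pM; rewrite ?enorm_ge0 ?(ltW m_gt) //.
    by rewrite subr_ge0 ler_pdivrMr.
  by rewrite lerBlDr -[X in X + _]mul1r -mulrDl ler_pdivlMr // addrC ltW.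
pose code v : 'I_m.+1 * F := (inord (j v), G (w ((j v)%:R / m%:R)) v).
have code_inj : {in q &, injective code}.
  move=> u v uq' vq /= [/(congr1 val)/=]; rewrite !inordK ?jm // => juv Guv.
  apply: (GP (w ((j u)%:R / m%:R))); rewrite ?near //.
  - by have [] := qP u uq'.
  - by have [] := qP v vq.
  - by rewrite juv near.
  - by rewrite Guv juv.
have := uniq_size_le_card uq code_inj; rewrite card_prod card_ord.
rewrite -(ler_nat R) natrM => /le_trans; apply.
by rewrite mulrC ler_wpM2l.
Qed.

(** Removing the loops of a chain in the tube leaves a chain without
    repetitions, whose length [tube_count] controls. *)
Lemma short_chain : exists K : R, 0 < K /\ forall x y, L x -> L y ->
  exists (k : nat) (p : nat -> 'rV[R]_n),
    [/\ p 0%N = x /\ p k = y, (forall i, (i <= k)%N -> L (p i)),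
        (forall i, (i < k)%N -> N (p i, p i.+1)) &
        k%:R <= K * (enorm (x - y) + K)].
Proof.
have [M countM] := tube_count.
exists (M%:R + 2); split=> [|x y Lx Ly]; first by rewrite ltr_wpDl.
have [k [p [[p0 pk] pL pN pS]]] := tube Lx Ly.
pose e : rel 'rV[R]_n := fun u v => `[< N (u, v) >].
have pth : path e x (map p (iota 1 k)).
  apply/(pathP x) => i; rewrite size_map size_iota => ik.
  rewrite (nth_map 0%N) ?size_iota // nth_iota // add1n.
  rewrite (_ : nth x _ i = p i); first by apply/asboolP/pN.
  case: i ik => [|i] ik /=; first by rewrite p0.
  by rewrite (nth_map 0%N) ?size_iota 1?ltnW // nth_iota 1?ltnW // add1n.
have lst : last x (map p (iota 1 k)) = y.
  rewrite -{1}p0 last_map -pk; congr p.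
  by rewrite (last_nth 0%N) size_iota -[0%N :: _]/(iota 0 k.+1) nth_iota.
move: lst; case/shortenP: pth => q pq uq sub_q lastq.
have qP v : v \in x :: q -> exists2 i, (i <= k)%N & v = p i.
  rewrite inE => /orP[/eqP ->|/sub_q /mapP[i]].
    by exists 0%N; rewrite ?p0.
  by rewrite mem_iota add1n ltnS => /andP[_ ik] ->; exists i.
have nthP i : (i <= size q)%N -> exists2 l, (l <= k)%N & nth x (x :: q) i = p l.
  by move=> iq; apply: qP; rewrite mem_nth.
exists (size q), (nth x (x :: q)); split.
- by rewrite nth_last /= lastq.
- by move=> i /nthP[l lk ->]; exact: pL.
- by move=> i iq; apply/asboolP; have /(pathP x) := pq; apply.
have : (size (x :: q))%:R <= M%:R * (enorm (x - y) + 2).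
  apply: countM => // v /qP[i ik ->]; split; [exact: pL|exact: pS].
have := enorm_ge0 (x - y); have : 0 <= M%:R :> R by [].
rewrite /= -natr1; nra.
Qed.

(** Density provides a second point of L, and a chain from x to it has to leave
    x at some step. *)
Lemma exists_other_neighbor x : (0 < n)%N -> L x ->
  exists2 y, N (x, y) & x != y.
Proof.
move=> n0 Lx; apply: contrapT => noN.
pose z := x + \row_(i < n) (s + 1).
have [y Ly zy] := dense z.
have [k [p [[p0 pk] _ pN _]]] := tube Lx Ly.
have px i : (i <= k)%N -> p i = x.
  elim: i => [//|i IHi] ik; apply/eqP; rewrite eq_sym; apply/negPn/negP => xp.
  by apply: noN; exists (p i.+1) => //; rewrite -(IHi (ltnW ik)); exact: pN.
move: zy; rewrite -pk px // /z addrC addrA addNr add0r => zs.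
have := le_trans (enorm_coord _ (Ordinal n0)) zs.
by rewrite mxE ger0_norm ?addr_ge0 ?(ltW s0) // gerDl ler10.
Qed.

(** * The combinatorial graph *)

Lemma graph_path_enorm k (x y : L) : graph_path N k x y ->
  enorm (val x - val y) <= S * k%:R.
Proof.
move=> [p [<- <- pN]]; elim: k pN => [|k IHk] pN.
  by rewrite subrr enorm0 mulr0.
rewrite (le_trans (enorm_triangle (val (p k)) _ _)) //.
rewrite -natr1 mulrDr mulr1 lerD ?IHk //; last exact/NS/pN.
by move=> i ik; apply: pN; exact: ltnW.
Qed.

Lemma cgraph_dist_min k (x y : L) : graph_path N k x y ->
  graph_path N (cgraph_dist N x y) x y /\ (cgraph_dist N x y <= k)%N.
Proof.
move=> pk; have ex : exists k, `[< graph_path N k x y >].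
  by exists k; apply/asboolP.
have [m /asboolP pm m_min] := ex_minnP ex.
rewrite /cgraph_dist; case: xgetP => [l _ [pl l_min]|/(_ m)[]].
  by split=> //; exact: l_min.
by split=> // j /asboolP/m_min.
Qed.

Lemma short_graph_path : exists K : R, 0 < K /\ forall x y : L,
  exists2 k, graph_path N k x y & k%:R <= K * (enorm (val x - val y) + K).
Proof.
have [K [K0 chain]] := short_chain.
exists K; split=> // x y.
have [k [p [[p0 pk] pL pN kK]]] := chain _ _ (set_valP x) (set_valP y).
have val_p i : (i <= k)%N -> val (insubd x (p i)) = p i.
  by move=> ik; rewrite insubdK //; apply: mem_set; exact: pL.
exists k => //; exists (fun i => insubd x (p i)); split.
- by apply/val_inj; rewrite val_p.
- by apply/val_inj; rewrite val_p.
- by move=> i ik; rewrite !val_p //; [exact: pN|exact: ltnW].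
Qed.

Lemma cgraph_dist_enorm (x y : L) :
  enorm (val x - val y) <= S * (cgraph_dist N x y)%:R.
Proof.
have [K [_ pathK]] := short_graph_path.
have [k /cgraph_dist_min[pd _] _] := pathK x y.
exact: graph_path_enorm.
Qed.

Lemma cgraph_bounded_geometry : bounded_geometry (cgraph L N).
Proof.
exists 0 => rho rho0.
have T0 : 0 <= S * rho by rewrite mulr_ge0 // ltW.
have [F packF] := finite_packing r0 T0 sep.
exists 1, #|F|%:R; split=> // x; apply/andP; split.
  apply: (@counting_ge1 _ _ _ x); rewrite /mms_cball /=.
  have /cgraph_dist_min[_] : graph_path N 0 x x by exists (fun=> x).
  by rewrite leqn0 => /eqP ->.
have [g gP] := packF (val x).
apply: (@counting_le_card _ _ F _ (fun y : L => g (val y))) => y z.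
rewrite !inE /mms_cball /= => xy xz gyz; apply/val_inj.
have near (u : L) : (cgraph_dist N x u)%:R <= rho ->
    enorm (val u - val x) <= S * rho.
  move=> xu; rewrite enormB (le_trans (cgraph_dist_enorm x u)) //.
  by rewrite ler_pM2l.
by apply: gP; rewrite ?near //; exact: set_valP.
Qed.

Lemma cgraph_coarsely_euclidean : coarsely_euclidean n (cgraph L N).
Proof.
split; last exact: cgraph_bounded_geometry.
have [K [K0 pathK]] := short_graph_path.
pose K' : R := K + S + s.
have [KK' SK' sK'] : [/\ K <= K', S <= K' & s <= K'].
  by split; have := s0; have := S0; rewrite /K'; lra.
have K'0 : 0 < K' by exact: lt_le_trans KK'.
exists val, K'; split=> //; split=> [x y|x y|x y|z] /=.
- by [].
- apply: (le_trans (cgraph_dist_enorm x y)).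
  by apply: ler_pM; rewrite ?lerDl ?(ltW S0) ?(ltW K'0).
- have [k /cgraph_dist_min[_ dk] kK] := pathK x y.
  apply: (le_trans (y := k%:R)); first by rewrite ler_nat.
  apply: (le_trans kK); apply: ler_pM => //; rewrite ?(ltW K0) //.
    by rewrite addr_ge0 ?enorm_ge0 // ltW.
  by rewrite lerD2l.
- have [x Lx zx] := dense z.
  by exists (SigSub (mem_set Lx)); rewrite enormB (le_trans zx).
Qed.

(** * The metric graph *)

Local Notation G := (mgraph_point N).

(** Gluing never moves the first component, so every point of the metric graph
    has a position in the ambient space. *)
Definition position (a : G) : 'rV[R]_n := (val (repr a)).1.

Lemma glued_fst (p q : edge_points N) : glued p q -> (val p).1 = (val q).1.
Proof.
move=> /asboolP; elim=> {p q} [p q|//|p q _ ->//|p q t _ -> _ ->//].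
by case=> [s' x y|x y z] -> ->.
Qed.

Lemma mgraph_class_position s' e (a : G) :
  mgraph_class (s', e) a -> position a = s'.
Proof.
move=> [p pE pa].
have /eqquotP/glued_fst : (repr a = p %[mod G])%qT by rewrite reprK pa.
by rewrite pE.
Qed.

Lemma mgraph_class_repr (a : G) : exists x y,
  [/\ mgraph_class (position a, (x, y)) a, N (x, y) &
      segment x y (position a)].
Proof.
case E : (val (repr a)) => [s' [x y]]; exists x, y.
have /set_mem[] := valP (repr a); rewrite /= E /= => Nxy sxy.
have pa : position a = s' by rewrite /position E.
by rewrite pa; split=> //; exists (repr a); rewrite ?reprK.
Qed.

Lemma mgraph_class_exists s' x y : N (x, y) -> segment x y s' ->
  exists a : G, mgraph_class (s', (x, y)) a.
Proof.
move=> Nxy sxy; have E : edge_points N (s', (x, y)) by [].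
pose p : edge_points N := SigSub (mem_set E).
by exists (\pi_(mgraph_point N)%qT p), p.
Qed.

Lemma mgraph_length_ge (a b : G) l :
  (mgraph_path_lengths a b `|` mgraph_segment_lengths a b) l ->
  enorm (position a - position b) <= l.
Proof.
case=> [[k [s' [t [p [k0 _ /mgraph_class_position -> /mgraph_class_position ->
  ->]]]]]|[s' [t [x [y [/mgraph_class_position -> /mgraph_class_position ->
  ->]]]]]] //.
apply: (le_trans (enorm_quad _ (p 1%N) (p k) _)).
by rewrite lerD2r lerD2l enorm_chain.
Qed.

Lemma mgraph_path2 (a b : G) s' t x y z :
  mgraph_class (s', (x, y)) a -> mgraph_class (t, (y, z)) b ->
  N (x, y) -> N (y, z) ->
  mgraph_path_lengths a b (enorm (s' - y) + enorm (y - t)).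
Proof.
move=> sa tb Nxy Nyz; exists 1%N, s', t, (fun j => nth x [:: x; y; z] j).
split=> //; first by case=> [|[]].
by rewrite big_geq // addr0.
Qed.

(** Prolong a short chain from the end y of the edge of a to the start u of the
    edge of b by these two edges. *)
Lemma short_mgraph_path : exists K : R, 1 <= K /\ forall a b : G,
  exists2 l, mgraph_path_lengths a b l &
    l <= K * (enorm (position a - position b) + K).
Proof.
have [K [K0 chain]] := short_chain.
(* The path has length at most S K (d + 2 S + K) + 2 S, d the distance of the
   positions. *)
exists (S * K + 2 * S + K + 1); split=> [|a b].
  by rewrite lerDr !addr_ge0 ?mulr_ge0 // ltW.
have [x [y [sa Nxy sxy]]] := mgraph_class_repr a.
have [u [v [tb Nuv tuv]]] := mgraph_class_repr b.
set s' := position a in sa sxy *; set t := position b in tb tuv *.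
have [_ Ly] := NL Nxy; have [Lu _] := NL Nuv.
have [k [q [[q0 qk] _ qN kK]]] := chain y u Ly Lu.
pose p j := if j is i.+1 then if (i <= k)%N then q i else v else x.
have p_q i : (i <= k)%N -> p i.+1 = q i by move=> ik; rewrite /p ik.
have pN j : (j <= k.+1)%N -> N (p j, p j.+1).
  case: j => [_|i]; first by rewrite p_q // q0.
  rewrite ltnS leq_eqVlt => /orP[/eqP ->|ik].
    by rewrite p_q // qk /p ltnn.
  by rewrite !p_q //; [exact: qN|exact: ltnW].
exists (enorm (s' - p 1%N) + \sum_(1 <= j < k.+1) enorm (p j - p j.+1)
        + enorm (p k.+1 - t)).
  exists k.+1, s', t, p; split=> //; first by rewrite p_q // q0.
  by rewrite p_q // qk /p ltnn.
have sumS : \sum_(1 <= j < k.+1) enorm (p j - p j.+1) <= k%:R * S.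
  apply: (@le_trans _ _ (\sum_(1 <= j < k.+1) S)).
    by apply: ler_sum_nat => j /andP[_ jk]; apply/NS/pN/ltnW.
  by rewrite sumr_const_nat subSS subn0 mulr_natl.
have sy : enorm (s' - y) <= S.
  have := segment_enorm (segment_sym sxy); have := NS (Nsym Nxy); lra.
have ut : enorm (u - t) <= S.
  rewrite enormB; have := segment_enorm tuv; have := NS Nuv; lra.
have yu : enorm (y - u) <= enorm (s' - t) + 2 * S.
  have := enorm_quad y s' t u.
  rewrite (enormB y s') (enormB t u); lra.
rewrite p_q // q0 p_q // qk.
set d := enorm (s' - t) in yu *.
have d0 : 0 <= d by exact: enorm_ge0.
have kS : k%:R * S <= K * (d + 2 * S + K) * S.
  apply: ler_wpM2r; first exact: ltW.
  by apply: (le_trans kK); rewrite ler_pM2l // lerD2r.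
have e : K * (d + 2 * S + K) * S = S * K * d + S * K * (2 * S + K) by ring.
have SK : 0 <= S * K by rewrite mulr_ge0 // ltW.
have := S0; move: (S * K) SK e => W W0 e S_gt0.
apply: (@le_trans _ _ (W * d + W * (2 * S + K) + 2 * S)); first lra.
have -> : (W + 2 * S + K + 1) * (d + (W + 2 * S + K + 1)) =
  W * d + W * (2 * S + K) + 2 * S + ((2 * S + K + 1) * d + W * (2 * S + K) +
   W ^+ 2 + 2 * W + (2 * S + K) ^+ 2 + 2 * S + 2 * K + 1) by ring.
rewrite lerDl !addr_ge0 ?mulr_ge0 ?sqr_ge0 ?addr_ge0 //; lra.
Qed.

Lemma mgraph_dist_ge (a b : G) :
  enorm (position a - position b) <= mgraph_dist a b.
Proof.
have [K [_ pathK]] := short_mgraph_path.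
have [l ab _] := pathK a b.
apply: lb_le_inf; first by exists l; left.
by move=> m; exact: mgraph_length_ge.
Qed.

Lemma mgraph_dist_le (a b : G) l :
  mgraph_path_lengths a b l -> mgraph_dist a b <= l.
Proof.
move=> ab; apply: ge_inf; last by left.
by exists (enorm (position a - position b)) => m; exact: mgraph_length_ge.
Qed.

(** The edge of a ends in a vertex x that has a neighbor z other than x.  The
    edge from x to z lies within 2S of a and has length at least 2r; one of
    its two orientations suffices for the bound r after the factor 1/2. *)
Lemma mgraph_cball_ge (a : G) (rho : R) : (0 < n)%N -> 2 * S <= rho ->
  (r%:E <= mms_measure (mms_cball (a : mgraph N) rho))%E.
Proof.
move=> n0 rhoS.
have [y [x [sa Nyx syx]]] := mgraph_class_repr a.
have [_ Lx] := NL Nyx.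
have [z Nxz xz] := exists_other_neighbor n0 Lx.
have [_ Lz] := NL Nxz.
have rz := sep Lx Lz xz.
have zx0 : 0 < enorm (z - x).
  by rewrite enormB (lt_le_trans _ rz) // mulr_gt0.
have trace_full :
    `]0, enorm (z - x)[ `<=` edge_trace (mms_cball (a : mgraph N) rho) (x, z).
  move=> u /=; rewrite in_itv /= => u01; split=> //.
  pose w := x + (u / enorm (z - x)) *: (z - x).
  have xzw : segment x z w.
    exists (u / enorm (z - x)) => //=; case/andP: u01 => u0 u1.
    by rewrite in_itv /= divr_ge0 ?ler_pdivrMr ?mul1r //; exact: ltW.
  have [b wb] := mgraph_class_exists Nxz xzw.
  exists b => //; apply: le_trans rhoS.
  apply: (le_trans (mgraph_dist_le (mgraph_path2 sa wb Nyx Nxz))).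
  have := segment_enorm (segment_sym syx); have := NS (Nsym Nyx).
  have := segment_enorm xzw; have := NS Nxz; rewrite (enormB x w); lra.
apply: (@le_trans _ _ ((2^-1)%:E * (2 * r)%:E)%E).
  by rewrite -EFinM mulKf.
rewrite /= /mgraph_measure lee_pmul2l //.
apply: esum_ge; exists [set (x, z)].
  by split; [exact: finite_set1|move=> _ ->].
rewrite fsbig_set1; apply: (le_trans _ (lebesgue_measure_mono trace_full)).
rewrite lebesgue_measure_itv /= lte_fin zx0 -EFinB subr0 lee_fin.
by rewrite enormB.
Qed.

(** Only the edges with both ends near the position of a meet the ball; their
    number is bounded by the packing, and each has length at most S. *)
Lemma mgraph_cball_le (rho : R) : 0 <= rho -> exists C : R, forall a : G,
  (mms_measure (mms_cball (a : mgraph N) rho) <= C%:E)%E.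
Proof.
move=> rho0; pose T := rho + 2 * S.
have T0 : 0 <= T by rewrite addr_ge0 // mulr_ge0 // ltW.
have [F packF] := finite_packing r0 T0 sep.
exists (2^-1 * (#|{: F * F}|%:R * S)) => a.
rewrite /= /mgraph_measure EFinM lee_pmul2l //.
have [g gP] := packF (position a).
pose near e :=
  [&& enorm (e.1 - position a) <= T & enorm (e.2 - position a) <= T].
set B := mms_cball _ _.
have trace_le e : N e ->
    (lebesgue_measure (edge_trace B e) <= (if near e then S else 0)%:E)%E.
  case: e => x y Nxy.
  have xyS : enorm (y - x) <= S by apply: NS; exact: Nsym.
  case: ifPn => [_|far].
    apply: (@le_trans _ _ (lebesgue_measure `]0, S[%classic)).
      apply: lebesgue_measure_mono => u /= [/andP[u0 u1] _].
      by rewrite in_itv /= u0 (lt_le_trans u1).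
    by rewrite lebesgue_measure_itv /= lte_fin S0 -EFinB subr0.
  rewrite (_ : edge_trace B (x, y) = set0) ?measure0 //.
  apply/seteqP; split=> // u [/= /andP[u0 u1] [b ab wb]].
  move: far; rewrite /near /=; apply/negP; rewrite negbK.
  have uS : enorm (x - position b) <= S.
    rewrite (mgraph_class_position wb) opprD addrA subrr add0r enormN enormZ.
    have d0 := lt_trans u0 u1.
    by rewrite ger0_norm ?divr_ge0 ?ltW // mulfVK ?gt_eqF // (lt_le_trans u1).
  have ba : enorm (position b - position a) <= rho.
    by rewrite enormB (le_trans (mgraph_dist_ge a b)).
  have := enorm_triangle (position b) x (position a).
  have := enorm_quad y x (position b) (position a).
  by rewrite /T; have := S0; move=> S_gt0 h1 h2; apply/andP; split; lra.
apply: ub_ereal_sup => _ [X [finX XN] <-].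
rewrite fsbig_finite //=.
apply: (@le_trans _ _ (\sum_(e <- fset_set X) (if near e then S else 0)%:E)%E).
  rewrite big_seq [leRHS]big_seq; apply: lee_sum => e.
  by rewrite in_fset_set // inE => /XN[Ne _]; exact: trace_le.
rewrite sumEFin lee_fin -big_mkcond /= -big_filter.
set q := [seq e <- fset_set X | near e].
have qX e : e \in q -> [/\ near e, L e.1 & L e.2].
  rewrite mem_filter in_fset_set // => /andP[ne].
  rewrite inE => /XN[]; case: e ne => x y ne /NL[].
  by split.
rewrite big_const_seq count_predT iter_addr_0.
rewrite -(mulr_natl S) ler_pM2r // ler_nat.
apply: (@uniq_size_le_card _ _ (fun e => (g e.1, g e.2))).
  by rewrite filter_uniq ?fset_uniq.
move=> [x y] [x' y'] /qX[/andP[xa ya] Lx Ly] /qX[/andP[xa' ya'] Lx' Ly'] /=.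
by case=> gx gy; congr pair; [exact: (gP x x')|exact: (gP y y')].
Qed.

Lemma mgraph_coarsely_euclidean : (0 < n)%N -> coarsely_euclidean n (mgraph N).
Proof.
move=> n0; split; last first.
  exists (2 * S) => rho rhoS.
  have rho0 : 0 <= rho by apply: le_trans rhoS; rewrite mulr_ge0 // ltW.
  have [C ballC] := mgraph_cball_le rho0.
  exists r, C; split=> // a.
  by apply/andP; split; [exact: mgraph_cball_ge|exact: ballC].
have [K [K1 pathK]] := short_mgraph_path.
pose K' : R := K + s.
have [KK' sK'] : K <= K' /\ s <= K' by split; have := s0; rewrite /K'; lra.
have K'0 : 0 < K' by lra.
exists position, K'; split=> //; split=> [a b|a b|a b|z] /=.
- exact: le_trans (enorm_ge0 _) (mgraph_dist_ge a b).
- apply: (le_trans (mgraph_dist_ge a b)).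
  have := le_trans (enorm_ge0 _) (mgraph_dist_ge a b).
  move: (mgraph_dist a b) => d d0.
  rewrite -[leLHS]mul1r; apply: ler_pM => //; first by lra.
  by rewrite lerDl ltW.
- have [l ab lK] := pathK a b.
  apply: (le_trans (mgraph_dist_le ab)); apply: (le_trans lK).
  apply: ler_pM => //; [lra| |by rewrite lerD2l].
  by rewrite addr_ge0 ?enorm_ge0 //; lra.
- have [x Lx zx] := dense z.
  have xx : segment x x x.
    by exists 0; rewrite ?scale0r ?addr0 //= in_itv /= lexx ler01.
  have [a /mgraph_class_position ax] := mgraph_class_exists (Nrefl Lx) xx.
  by exists a; rewrite ax enormB (le_trans zx).
Qed.

End neighbors.

Theorem corollary1p8 (R : realType) (n : nat) (L : set 'rV[R]_n)
    (N : set ('rV[R]_n * 'rV[R]_n)) :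
  (0 < n)%N -> delone L -> neighbor_relation L N ->
  [/\ roughly_isometric (euclidean_space R n) (cgraph L N),
      roughly_isometric (euclidean_space R n) (mgraph N) &
      roughly_isometric (cgraph L N) (mgraph N)] /\
  [/\ roughly_isometric (cgraph L N) (euclidean_space R n),
      roughly_isometric (mgraph N) (euclidean_space R n) &
      roughly_isometric (mgraph N) (cgraph L N)].
Proof.
move=> n0 [r [s [r0 s0 sep cov]]] [NL [S [S0 [[Nsym Nrefl] NS tube]]]].
have dense z : exists2 x, L x & enorm (z - x) <= s.
  by have [x Lx zx] : (\bigcup_(x in L) [set z | enorm (z - x) <= s]) z;
    [rewrite cov|exists x].
have E := euclidean_coarsely_euclidean R n.
have C : coarsely_euclidean n (cgraph L N).
  exact: (cgraph_coarsely_euclidean r0 s0 S0 sep dense NS tube).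
have M : coarsely_euclidean n (mgraph N).
  exact: (mgraph_coarsely_euclidean r0 s0 S0 sep dense NL Nsym Nrefl NS tube).
by split; split; exact: (@coarsely_euclidean_roughly_isometric _ n).
Qed.
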